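(* Let $\theta=(W_L,W_{L-1},\ldots,W_1)\in\mathbb{R}^{d_\theta}$ be a weight vector. Then $$\operatorname{null}\mathrm{d}\mu(\theta)=\Bigl\{(Y_L,Y_{L-1},\ldots,Y_1):Y_j=\Delta W_j+W_jH_{j-1}-H_jW_j\ (1\le j\le L)\Bigr\},$$ where $H_0=0$ and $H_L=0$, the matrices $H_j\in\mathbb{R}^{d_j\times d_j}$ ($1\le j\le L-1$) range over all such matrices, and each $\Delta W_j$ ranges independently over $$\operatorname{null}W_{L\sim j}\otimes\mathbb{R}^{d_{j-1}}+\mathbb{R}^{d_j}\otimes\operatorname{null}W_{j-1\sim0}^\top.$$
   Context: Fix integers $L\ge1$ and $d_0,\ldots,d_L\ge1$. The weight space is $\mathbb{R}^{d_\theta}=\mathbb{R}^{d_L\times d_{L-1}}\times\cdots\times\mathbb{R}^{d_1\times d_0}$; a weight vector is $\theta=(W_L,\ldots,W_1)$ with $W_j\in\mathbb{R}^{d_j\times d_{j-1}}$. For $L\ge k\ge i\ge0$, $W_{k\sim i}=W_kW_{k-1}\cdots W_{i+1}$, with $W_{k\sim k}=I_{d_k\times d_k}$ (so $\operatorname{null}W_{L\sim L}=\{\mathbf 0\}$ and $\operatorname{null}W_{0\sim0}^\top=\{\mathbf 0\}$). $\mu(\theta)=W_{L\sim0}$, and its differential map at $\theta$ is the linear map $\mathrm{d}\mu(\theta):\mathbb{R}^{d_\theta}\to\mathbb{R}^{d_L\times d_0}$, $\mathrm{d}\mu(\theta)(\Delta W_L,\ldots,\Delta W_1)=\sum_{j=1}^LW_{L\sim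 j}\Delta W_jW_{j-1\sim0}$. For $U\subseteq\mathbb{R}^p$, $V\subseteq\mathbb{R}^q$, $U\otimes V=\{M\in\mathbb{R}^{p\times q}:\operatorname{col}M\subseteq U,\ \operatorname{row}M\subseteq V\}$. *)

(* Defs.v *)
From mathcomp Require Import all_boot all_order all_algebra.
From mathcomp Require Import boolp classical_sets reals.

Set Implicit Arguments.
Unset Strict Implicit.
Unset Printing Implicit Defensive.

Import GRing.Theory.

Local Open Scope ring_scope.
Local Open Scope classical_set_scope.

(* The weight space. Indices are shifted by one: for W : weights R L d and
   j : 'I_L, the matrix W j is the mathematical W_(j+1), of size
   d_(j+1) x d_j. Only d 0, ..., d L are relevant. *)
Definition weights (R : realType) (L : nat) (d : nat -> nat) : Type :=
  forall j : 'I_L, 'M[R]_(d j.+1, d j).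

(* W extended by zero matrices to all natural indices; only a device to write
   products of consecutive factors without carrying bound proofs. *)
Definition wext (R : realType) (L : nat) (d : nat -> nat) (W : weights R L d)
    (j : nat) : 'M[R]_(d j.+1, d j) :=
  match @idP (j < L)%N with
  | ReflectT jL => W (Ordinal jL)
  | ReflectF _ => 0
  end.

(* For i <= k <= L, subprod W k i is W_(k~i) = W_k W_(k-1) ... W_(i+1).
   The term pid_mx (d i) has the required type for all k and i and is the
   identity matrix when k = i (see subprodkk); when k < i the value is
   meaningless and never used. *)
Fixpoint subprod (R : realType) (L : nat) (d : nat -> nat) (W : weights R L d)
    (k i : nat) : 'M[R]_(d k, d i) :=
  match k with
  | 0 => pid_mx (d i)
  | k'.+1 => if (i <= k')%N then wext W k' *m subprod W k' i else pid_mx (d i)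
  end.

Lemma wextE (R : realType) (L : nat) (d : nat -> nat) (W : weights R L d)
    (j : 'I_L) : wext W j = W j.
Proof.
rewrite /wext; case: {-}_ / idP => [jL|]; last by case; exact: ltn_ord.
by case: j jL => j jL jL' /=; rewrite (bool_irrelevance jL' jL).
Qed.

Lemma subprodkk (R : realType) (L : nat) (d : nat -> nat) (W : weights R L d)
    (k : nat) : subprod W k k = 1%:M.
Proof. by case: k => [|k] /=; rewrite ?ltnn pid_mx_1. Qed.

Lemma subprodS (R : realType) (L : nat) (d : nat -> nat) (W : weights R L d)
    (k : 'I_L) (i : nat) :
  (i <= k)%N -> subprod W k.+1 i = W k *m subprod W k i.
Proof. by move=> ik /=; rewrite ik wextE. Qed.

(* The differential at W of the map mu : W |-> W_L ... W_1 = subprod W L 0,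
   applied to dW: the sum of the W_(L~j) dW_j W_(j-1~0) for 1 <= j <= L. *)
Definition dmu (R : realType) (L : nat) (d : nat -> nat) (W dW : weights R L d) :
    'M[R]_(d L, d 0) :=
  \sum_(j < L) subprod W L j.+1 *m dW j *m subprod W j 0.

Definition null_dmu (R : realType) (L : nat) (d : nat -> nat)
    (W : weights R L d) : set (weights R L d) :=
  [set dW | dmu W dW = 0].

Definition nullsp (R : realType) (p q : nat) (A : 'M[R]_(p, q)) :
    set 'cV[R]_q :=
  [set x | A *m x = 0].

Definition colsp (R : realType) (p q : nat) (A : 'M[R]_(p, q)) :
    set 'cV[R]_p :=
  range (fun x : 'cV[R]_q => A *m x).

(* Elements of the row space are represented as column vectors, so that every
   subset of R^q has type set 'cV[R]_q. *)
Definition rowsp (R : realType) (p q : nat) (A : 'M[R]_(p, q)) :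
    set 'cV[R]_q :=
  colsp A^T.

Definition tensorsp (R : realType) (p q : nat) (U : set 'cV[R]_p)
    (V : set 'cV[R]_q) : set 'M[R]_(p, q) :=
  [set M | colsp M `<=` U /\ rowsp M `<=` V].

Definition sumsp (R : realType) (p q : nat) (A B : set 'M[R]_(p, q)) :
    set 'M[R]_(p, q) :=
  [set M + N | M in A & N in B].

(* Main.v *)
Require Import Defs.
From mathcomp Require Import all_boot all_order all_algebra.
From mathcomp Require Import boolp classical_sets reals.

Set Implicit Arguments.
Unset Strict Implicit.

Import GRing.Theory.

Local Open Scope ring_scope.
Local Open Scope classical_set_scope.

(** Write A_j = W_(L~j) and B_j = W_(j~0), so that A_(j-1) = A_j W_j and
B_j = W_j B_(j-1). The condition on each ΔW_j says exactly that
A_j ΔW_j B_(j-1) = 0, and the terms coming from the H_j telescope, which gives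
one inclusion. Conversely, for Y in the null space of the differential, the
partial sum S_j of the A_i Y_i B_(i-1) over i <= j has its column space in that
of A_j, and, being the opposite of the sum over i > j, its row space in that of
B_j. Hence A_j H_j B_j = - S_j is solved by means of generalized inverses of A_j
and B_j, with H_0 = H_L = 0 since S_0 = S_L = 0, and this choice makes
ΔW_j = Y_j - W_j H_(j-1) + H_j W_j satisfy A_j ΔW_j B_(j-1) = 0. *)

Lemma mulmx_cV_eq0 (R : realType) (p q : nat) (C : 'M[R]_(p, q)) :
  (forall x : 'cV_q, C *m x = 0) -> C = 0.
Proof.
move=> C0; apply/matrixP => i j.
by have /matrixP/(_ i 0) := C0 (delta_mx j 0); rewrite -colE !mxE.
Qed.

Lemma tensorsp_nullspT (R : realType) (m p q : nat) (A : 'M[R]_(m, p))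
    (M : 'M[R]_(p, q)) :
  tensorsp (nullsp A) [set: 'cV[R]_q] M <-> A *m M = 0.
Proof.
split=> [[colM _]|AM0].
  apply: mulmx_cV_eq0 => x; rewrite -mulmxA.
  by apply: (colM (M *m x)); exists x.
by split=> // _ [x _ <-]; rewrite /nullsp /= mulmxA AM0 mul0mx.
Qed.

(** Row spaces consist of column vectors, so the condition on [M] is really [B^T *m M^T = 0];
    transposing removes it. *)
Lemma tensorspT_nullsp (R : realType) (p q n : nat) (B : 'M[R]_(q, n))
    (M : 'M[R]_(p, q)) :
  tensorsp [set: 'cV[R]_p] (nullsp B^T) M <-> M *m B = 0.
Proof.
split=> [[_ rowM]|MB0].
  apply: trmx_inj; rewrite trmx_mul trmx0.
  apply: mulmx_cV_eq0 => x; rewrite -mulmxA.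
  by apply: (rowM (M^T *m x)); exists x.
split=> // _ [x _ <-].
by rewrite /nullsp /= mulmxA -trmx_mul MB0 trmx0 mul0mx.
Qed.

Lemma mulmx_pinvmxK (F : fieldType) (m n : nat) (A : 'M[F]_(m, n)) :
  A *m pinvmx A *m A = A.
Proof. exact: mulmxKpV (submx_refl A). Qed.

Lemma sumsp_nullspP (R : realType) (m p q n : nat) (A : 'M[R]_(m, p))
    (B : 'M[R]_(q, n)) (M : 'M[R]_(p, q)) :
  sumsp (tensorsp (nullsp A) [set: 'cV[R]_q])
        (tensorsp [set: 'cV[R]_p] (nullsp B^T)) M <-> A *m M *m B = 0.
Proof.
split=> [[M1 /tensorsp_nullspT AM1 [M2 /tensorspT_nullsp M2B <-]]|AMB].
  by rewrite mulmxDr AM1 add0r -mulmxA M2B mulmx0.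
(* The projector [pinvmx A *m A] splits [M]: the part it removes is killed by [A] on the left, and
   the part it keeps factors through [A *m M], which [B] kills on the right. *)
exists (M - pinvmx A *m A *m M).
  by apply/tensorsp_nullspT; rewrite mulmxBr mulmxA (mulmxA A) mulmx_pinvmxK subrr.
exists (pinvmx A *m A *m M); last by rewrite subrK.
by apply/tensorspT_nullsp; rewrite -(mulmxA _ A M) -(mulmxA _ _ B) AMB mulmx0.
Qed.

Lemma subprod_mul (R : realType) (L : nat) (d : nat -> nat)
    (W : weights R L d) (k j i : nat) :
  (i <= j)%N -> (j <= k)%N -> subprod W k i = subprod W k j *m subprod W j i.
Proof.
move=> ij; elim: k => [|k IHk].
  by rewrite leqn0 => /eqP ->; rewrite subprodkk mul1mx.
rewrite leq_eqVlt => /predU1P[->|]; first by rewrite subprodkk mul1mx.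
rewrite ltnS => jk /=.
by rewrite jk (leq_trans ij jk) IHk // mulmxA.
Qed.

(** [subprod] unfolds only at its left end, so a factor on the right is absorbed by splitting the
    product at [j.+1]. *)
Lemma subprod_mulW (R : realType) (L : nat) (d : nat -> nat)
    (W : weights R L d) (j : 'I_L) :
  subprod W L j.+1 *m W j = subprod W L j.
Proof.
rewrite (@subprod_mul _ _ _ _ L j.+1 j) //.
by rewrite subprodS // subprodkk mulmx1.
Qed.

(** [W j] is absorbed by the left product in one term and by the right product in the other, leaving
    consecutive values of a single function of the index. *)
Lemma dmu_gauge (R : realType) (L : nat) (d : nat -> nat) (W : weights R L d)
    (H : forall j, 'M[R]_(d j)) (j : 'I_L) :
  subprod W L j.+1 *m (W j *m H j - H j.+1 *m W j) *m subprod W j 0 =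
  subprod W L j *m H j *m subprod W j 0
  - subprod W L j.+1 *m H j.+1 *m subprod W j.+1 0.
Proof.
rewrite mulmxBr mulmxBl (mulmxA _ (W j)) subprod_mulW subprodS //.
by rewrite (mulmxA _ (H j.+1)) -(mulmxA _ (W j)).
Qed.

Definition partial_dmu (R : realType) (L : nat) (d : nat -> nat)
    (W Y : weights R L d) (j : nat) : 'M[R]_(d L, d 0) :=
  \sum_(i < L | (i < j)%N) subprod W L i.+1 *m Y i *m subprod W i 0.

Lemma partial_dmu0 (R : realType) (L : nat) (d : nat -> nat)
    (W Y : weights R L d) : partial_dmu W Y 0 = 0.
Proof. exact: big_pred0. Qed.

Lemma partial_dmuL (R : realType) (L : nat) (d : nat -> nat)
    (W Y : weights R L d) : partial_dmu W Y L = dmu W Y.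
Proof. by apply: eq_bigl => i; rewrite ltn_ord. Qed.

Lemma partial_dmuS (R : realType) (L : nat) (d : nat -> nat)
    (W Y : weights R L d) (j : 'I_L) :
  partial_dmu W Y j.+1 =
  subprod W L j.+1 *m Y j *m subprod W j 0 + partial_dmu W Y j.
Proof.
rewrite /partial_dmu (bigD1 j) //=; congr (_ + _); apply: eq_bigl => i.
by rewrite ltnS [in RHS]ltn_neqAle andbC.
Qed.

Lemma partial_dmu_colE (R : realType) (L : nat) (d : nat -> nat)
    (W Y : weights R L d) (j : nat) : (j <= L)%N ->
  exists X, partial_dmu W Y j = subprod W L j *m X.
Proof.
move=> jL.
exists (\sum_(i < L | (i < j)%N) subprod W j i.+1 *m Y i *m subprod W i 0).
rewrite mulmx_sumr; apply: eq_bigr => i ij.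
by rewrite (@subprod_mul _ _ _ _ L j) // !mulmxA.
Qed.

Lemma partial_dmu_rowE (R : realType) (L : nat) (d : nat -> nat)
    (W Y : weights R L d) (j : nat) : dmu W Y = 0 ->
  exists X, partial_dmu W Y j = X *m subprod W j 0.
Proof.
rewrite /dmu (bigID (fun i : 'I_L => (i < j)%N)) /= => /eqP.
rewrite addr_eq0 => /eqP; rewrite -/(partial_dmu W Y j) => ->.
exists (- \sum_(i < L | ~~ (i < j)%N)
          subprod W L i.+1 *m Y i *m subprod W i j).
rewrite mulNmx mulmx_suml; congr (- _); apply: eq_bigr => i.
by rewrite -leqNgt => ji; rewrite (@subprod_mul _ _ _ _ i j 0) // !mulmxA.
Qed.

Definition gauge (R : realType) (L : nat) (d : nat -> nat)
    (W Y : weights R L d) (j : nat) : 'M[R]_(d j) :=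
  - (pinvmx (subprod W L j) *m partial_dmu W Y j *m pinvmx (subprod W j 0)).

Lemma gaugeE (R : realType) (L : nat) (d : nat -> nat)
    (W Y : weights R L d) (j : nat) : (j <= L)%N -> dmu W Y = 0 ->
  subprod W L j *m gauge W Y j *m subprod W j 0 = - partial_dmu W Y j.
Proof.
move=> jL Y0; rewrite mulmxN mulNmx; congr (- _).
have [X SX] := partial_dmu_colE W Y jL.
have [Z SZ] := partial_dmu_rowE j Y0.
set A := subprod W L j in SX *; set B := subprod W j 0 in SZ *.
set S := partial_dmu W Y j in SX SZ *.
(* [A *m pinvmx A] fixes [S] because [S = A *m X]; likewise [pinvmx B *m B] fixes it on the right
   because [S = Z *m B]. *)
have AS : A *m (pinvmx A *m S) = S.
  by rewrite {1}SX mulmxA (mulmxA _ A X) mulmx_pinvmxK -SX.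
by rewrite mulmxA AS {1}SZ -(mulmxA Z B) -mulmxA mulmx_pinvmxK.
Qed.

Unset Implicit Arguments.
Set Strict Implicit.

(* The index j : 'I_L stands for j + 1 in 1, ..., L. *)
Theorem mainTheorem9 (R : realType) (L : nat) (d : nat -> nat)
    (L_gt0 : (1 <= L)%N) (d_gt0 : forall i : nat, (i <= L)%N -> (1 <= d i)%N)
    (W : weights R L d) :
  null_dmu W =
  [set Y : weights R L d |
    exists (H : forall j : nat, 'M[R]_(d j)) (dW : weights R L d),
      [/\ H 0%N = 0, H L = 0,
          forall j : 'I_L,
            sumsp (tensorsp (nullsp (subprod W L j.+1)) [set: 'cV[R]_(d j)])
                  (tensorsp [set: 'cV[R]_(d j.+1)] (nullsp (subprod W j 0)^T))
                  (dW j)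
        & forall j : 'I_L, Y j = dW j + W j *m H j - H j.+1 *m W j]].
Proof.
apply/seteqP; split=> Y /=.
  rewrite /null_dmu /= => Y0.
  exists (gauge W Y).
  exists (fun j => Y j - (W j *m gauge W Y j - gauge W Y j.+1 *m W j)).
  split.
  - by rewrite /gauge partial_dmu0 mulmx0 mul0mx oppr0.
  - by rewrite /gauge partial_dmuL Y0 mulmx0 mul0mx oppr0.
  - move=> j; apply/sumsp_nullspP.
    rewrite mulmxBr mulmxBl dmu_gauge !gaugeE //; last exact: ltnW.
    (* The gauge contributes the increment of the partial sums from [j] to [j.+1], which is exactly
       the term of [Y j]. *)
    by rewrite partial_dmuS opprK addrCA addNr addr0 subrr.
  - by move=> j; rewrite -addrA subrK.
move=> [H [dW [H0 HL dW0 YE]]]; rewrite /null_dmu /= /dmu.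
under eq_bigr => j _.
  rewrite YE -addrA mulmxDr mulmxDl (iffLR (sumsp_nullspP _ _ _) (dW0 j)) add0r.
  rewrite dmu_gauge -opprB; over.
(* The sign is pulled out so that each term is the value at [j.+1] minus the value at [j], the form
   in which the sum telescopes to its two ends. *)
rewrite sumrN -(big_mkord xpredT (fun j =>
  subprod W L j.+1 *m H j.+1 *m subprod W j.+1 0
  - subprod W L j *m H j *m subprod W j 0)).
rewrite telescope_sumr // H0 HL.
by rewrite !mulmx0 !mul0mx subrr oppr0.
Qed.
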